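(* Let $\Omega_0 := \mathbb{R}\times(0,1)\subset\mathbb{R}^2$ with coordinates $(x,y)$, and let $R := \sqrt{x^2+y^2}$. Consider the following Dirichlet problem for a real-valued function $v$: $$\big((1+x^2)v_x\big)_x+\big((1-y^2)v_y\big)_y=0\quad\text{in }\Omega_0,$$ $$v(x,0)=0\quad\text{for all }x\neq0,$$ $$v(x,1)=\frac{1}{1+x^2}\quad\text{for all }x\in\mathbb{R},$$ $$v(x,y)=\frac{y}{x^2}+O_1(x^{-3})\quad\text{as }|x|\to\infty,$$ $$v(x,y)=\frac{y}{R^2}+o_1\!\left(\frac1R\right)\quad\text{as }R\to0.$$ Then $$v_0(x,y):=\frac{y}{R^2}=\frac{y}{x^2+y^2}$$ is the only solution of this Dirichlet problem in $C^2(\Omega_0)\cap C(\overline{\Omega_0}\setminus\{(0,0)\})$.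
   Context: The subscript $1$ in $O_1$ and $o_1$ means that upon differentiation the decay rate at infinity improves by one power and the blow-up rate at zero worsens by one power. Explicitly: a remainder $f$ is $O_1(x^{-3})$ as $|x|\to\infty$ if $f=O(|x|^{-3})$ and its first partial derivatives satisfy $f_x,f_y=O(|x|^{-4})$ as $|x|\to\infty$, uniformly in $y\in(0,1)$; a remainder $f$ is $o_1(1/R)$ as $R\to0$ if $f=o(1/R)$ and $f_x,f_y=o(1/R^2)$ as $R\to 0$ within $\Omega_0$ (uniformly in direction). *)

(* Defs.v *)
From Stdlib Require Import Reals.
From Coquelicot Require Import Coquelicot.
Open Scope R_scope.

(* Functions of two real variables are total functions [R -> R -> R]; only their
   values on [Omega0_closure_star] matter below. *)

Definition Omega0 (p : R * R) : Prop := 0 < snd p < 1.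

(* closure of [Omega0] with the origin removed *)
Definition Omega0_closure_star (p : R * R) : Prop :=
  0 <= snd p <= 1 /\ p <> (0, 0).

Definition rad (x y : R) : R := sqrt (x ^ 2 + y ^ 2).

Definition dx (f : R -> R -> R) (x y : R) : R := Derive (fun s => f s y) x.
Definition dy (f : R -> R -> R) (x y : R) : R := Derive (fun t => f x t) y.

(* f = O(|x|^-k) as |x| -> oo in Omega0, uniformly in y *)
Definition bigO_infty (k : nat) (f : R -> R -> R) : Prop :=
  exists C M : R, 0 < M /\ forall x y : R,
    Omega0 (x, y) -> M < Rabs x -> Rabs (f x y) <= C / Rabs x ^ k.

Definition bigO1_infty (k : nat) (f : R -> R -> R) : Prop :=
  bigO_infty k f /\ bigO_infty (S k) (dx f) /\ bigO_infty (S k) (dy f).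

(* f = o(rad^-k) as rad -> 0 in Omega0; [is_domin F g f] means f = o(g) along F *)
Definition littleo_zero (k : nat) (f : R -> R -> R) : Prop :=
  is_domin (within Omega0 (locally ((0, 0) : R * R)))
    (fun p : R * R => / rad (fst p) (snd p) ^ k)
    (fun p : R * R => f (fst p) (snd p)).

Definition littleo1_zero (k : nat) (f : R -> R -> R) : Prop :=
  littleo_zero k f /\ littleo_zero (S k) (dx f) /\ littleo_zero (S k) (dy f).

(* membership in C^2(Omega0) and in C(closure(Omega0) minus the origin) *)
Definition regular (v : R -> R -> R) : Prop :=
  (forall x y : R, Omega0 (x, y) -> ex_diff_n v 2 x y) /\
  continuous_on Omega0_closure_star (fun p : R * R => v (fst p) (snd p)).

Definition dirichlet_problem (v : R -> R -> R) : Prop :=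
  (forall x y : R, Omega0 (x, y) ->
     dx (fun s t => (1 + s ^ 2) * dx v s t) x y +
     dy (fun s t => (1 - t ^ 2) * dy v s t) x y = 0) /\
  (forall x : R, x <> 0 -> v x 0 = 0) /\
  (forall x : R, v x 1 = 1 / (1 + x ^ 2)) /\
  bigO1_infty 3 (fun x y => v x y - y / x ^ 2) /\
  littleo1_zero 1 (fun x y => v x y - y / rad x y ^ 2).

Definition v0 (x y : R) : R := y / rad x y ^ 2.

(* Main.v *)
(* A solution [v] and [v0] are compared by the maximum principle for
   L u = ((1 + x^2) u_x)_x + ((1 - y^2) u_y)_y, which has no zeroth-order term.
   The difference w = v - v0 vanishes on both boundary lines and at infinity.
   Near the origin, w = o(1/R) in the sector |x| <= y, while integrating
   w_y = o(1/R^2) from y = 0 gives w = o(y/R^2) in the sectors y < |x|; hence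
   |w| <= e v0 near the origin for every e > 0.  As v0 is itself a positive
   solution, the maximum principle applied to w - e v0 and - w - e v0 yields
   |w| <= e v0 everywhere. *)
Require Import Defs.
From Stdlib Require Import Reals.
From Coquelicot Require Import Coquelicot.
From Stdlib Require Import Lra List Classical ClassicalEpsilon.
Open Scope R_scope.

(** If no point were a maximum, each point would have a neighbourhood on which [f] stays below one
    of its values. Finitely many neighbourhoods cover the rectangle, and the largest of their values
    would then lie strictly above itself. Semicontinuity asks for upper bounds only, which is what
    sign conditions provide at a singular point. *)
Lemma usc_attains_max (f : R -> R -> R) (a b c d : R) :
  a <= b -> c <= d ->
  (forall x y s, a <= x <= b -> c <= y <= d -> f x y < s ->
     exists r : posreal, forall x' y', a <= x' <= b -> c <= y' <= d ->
       Rabs (x' - x) < r -> Rabs (y' - y) < r -> f x' y' < s) ->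
  exists x0 y0, a <= x0 <= b /\ c <= y0 <= d /\
    forall x y, a <= x <= b -> c <= y <= d -> f x y <= f x0 y0.
Proof.
intros Hab Hcd Husc.
apply NNPP; intros Hno.
assert (Hup : forall x y, a <= x <= b -> c <= y <= d ->
  exists x' y', a <= x' <= b /\ c <= y' <= d /\ f x y < f x' y').
{ intros x y Hx Hy. apply NNPP; intros H. apply Hno.
  exists x, y. repeat split; try lra.
  intros x' y' Hx' Hy'. apply Rnot_lt_le; intros Hlt. apply H.
  exists x', y'. tauto. }
set (good := fun (x y : R) (r : posreal) => a <= x <= b -> c <= y <= d ->
  exists x1 y1, a <= x1 <= b /\ c <= y1 <= d /\
    forall x' y', a <= x' <= b -> c <= y' <= d ->
      Rabs (x' - x) < r -> Rabs (y' - y) < r -> f x' y' < f x1 y1).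
assert (Hgood : forall x y, exists r, good x y r).
{ intros x y.
  destruct (classic (a <= x <= b /\ c <= y <= d)) as [[Hx Hy]|Hn].
  - destruct (Hup x y Hx Hy) as (x1 & y1 & Hx1 & Hy1 & Hlt).
    destruct (Husc x y _ Hx Hy Hlt) as [r Hr].
    exists r. intros _ _. exists x1, y1. auto.
  - exists (mkposreal 1 Rlt_0_1). intros Hx Hy. tauto. }
set (delta := fun t : Compactness.Tn 2 R =>
  proj1_sig (constructive_indefinite_description _ (Hgood (fst t) (fst (snd t))))).
(* The finite cover comes under a double negation, which suffices as the goal is [False]. *)
apply (compactness_list 2 (a, (c, tt)) (b, (d, tt)) delta).
intros [l Hl].
(* One value dominates [f] on all the listed neighbourhoods: the induction keeps the larger of two
   candidates. *)
assert (Hm : exists x1 y1, a <= x1 <= b /\ c <= y1 <= d /\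
  forall t, In t l -> a <= fst t <= b -> c <= fst (snd t) <= d ->
    forall x' y', a <= x' <= b -> c <= y' <= d ->
      Rabs (x' - fst t) < delta t -> Rabs (y' - fst (snd t)) < delta t ->
      f x' y' < f x1 y1).
{ clear Hl. induction l as [|t l (x1 & y1 & Hx1 & Hy1 & H1)].
  - exists a, c. repeat split; try lra. intros t [].
  - destruct (classic (a <= fst t <= b /\ c <= fst (snd t) <= d)) as [[Hx Hy]|Hn].
    + assert (Ht : good (fst t) (fst (snd t)) (delta t)).
      { unfold delta. apply proj2_sig. }
      destruct (Ht Hx Hy) as (x2 & y2 & Hx2 & Hy2 & H2).
      destruct (Rle_lt_dec (f x1 y1) (f x2 y2)) as [Hle|Hlt].
      * exists x2, y2. split; [exact Hx2|split; [exact Hy2|]].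
        intros t' [->|Hin] Hxt Hyt x' y' Hx' Hy' Hdx Hdy; [now apply H2|].
        eapply Rlt_le_trans; [|exact Hle]. now apply (H1 t').
      * exists x1, y1. split; [exact Hx1|split; [exact Hy1|]].
        intros t' [->|Hin] Hxt Hyt x' y' Hx' Hy' Hdx Hdy; [|now apply (H1 t')].
        eapply Rlt_trans; [|exact Hlt]. now apply H2.
    + exists x1, y1. split; [exact Hx1|split; [exact Hy1|]].
      intros t' [->|Hin] Hxt Hyt; [tauto|now apply H1]. }
destruct Hm as (x1 & y1 & Hx1 & Hy1 & Hm).
destruct (Hl (x1, (y1, tt))) as ((x & y & []) & Hin & Hb & Hc).
{ simpl. tauto. }
simpl in Hb, Hc.
apply (Rlt_irrefl (f x1 y1)).
apply (Hm (x, (y, tt))); simpl; tauto.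
Qed.

(* [is_derive_ext] with the equation at type [R], where [ring] applies. *)
Lemma is_derive_Rext (f g : R -> R) (x l : R) :
  (forall t, f t = g t) -> is_derive f x l -> is_derive g x l.
Proof. intros H. now apply is_derive_ext. Qed.

(** At the maximum [g c = 0]. If the flux [p g] had positive derivative there, [g] would be positive
    just to the right of [c], and the mean value theorem would push [f] above [f c]. Only the flux
    is differentiated, as in the equation. *)
Lemma flux_at_max (f g p : R -> R) (a b c l : R) :
  a < c < b ->
  (forall x, a < x < b -> is_derive f x (g x)) ->
  (forall x, a < x < b -> 0 < p x) ->
  (forall x, a < x < b -> f x <= f c) ->
  is_derive (fun x => p x * g x) c l ->
  l <= 0.
Proof.
intros Hc Hf Hp Hmax Hl.
assert (Hg : g c = 0).
{ assert (pr : derivable_pt f c).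
  { exists (g c). apply is_derive_Reals, Hf, Hc. }
  rewrite <- (deriv_maximum f a b c pr (proj1 Hc) (proj2 Hc)).
  - symmetry. apply derive_pt_eq_0, is_derive_Reals, Hf, Hc.
  - intros x H1 H2. apply Hmax. lra. }
apply Rnot_lt_le; intros Hpos.
apply is_derive_Reals in Hl.
destruct (Hl l Hpos) as [d Hd].
pose proof (cond_pos d) as Hd0.
set (e := Rmin d (b - c) / 2).
assert (He : 0 < e /\ e < d /\ e < b - c).
{ unfold e. pose proof (Rmin_l d (b - c)). pose proof (Rmin_r d (b - c)).
  assert (0 < Rmin d (b - c)) by (apply Rmin_pos; lra). lra. }
destruct (MVT_cor2 f g c (c + e)) as (z & Heq & Hz).
{ lra. }
{ intros x Hx. apply is_derive_Reals, Hf. lra. }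
assert (Hzd : Rabs (z - c) < d) by (rewrite Rabs_right; lra).
specialize (Hd (z - c) ltac:(lra) Hzd).
replace (c + (z - c)) with z in Hd by ring.
rewrite Hg, Rmult_0_r, Rminus_0_r in Hd.
apply Rabs_def2 in Hd. destruct Hd as [_ Hd].
assert (Hq : 0 < p z * g z / (z - c)) by lra.
assert (Hgz : 0 < g z).
{ apply (Rmult_lt_reg_l (p z)); [apply Hp; lra|].
  rewrite Rmult_0_r.
  replace (p z * g z) with (p z * g z / (z - c) * (z - c)) by (field; lra).
  apply Rmult_lt_0_compat; lra. }
assert (f (c + e) <= f c) by (apply Hmax; lra).
assert (0 < g z * (c + e - c)) by (apply Rmult_lt_0_compat; lra).
lra.
Qed.

(* The common value [A] of the two flux derivatives up to sign makes this class
   visibly linear. *)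
Definition flux_harmonic (u : R -> R -> R) : Prop :=
  exists ux uy A : R -> R -> R, forall x y, Omega0 (x, y) ->
    is_derive (fun s => u s y) x (ux x y) /\
    is_derive (fun t => u x t) y (uy x y) /\
    is_derive (fun s => (1 + s ^ 2) * ux s y) x (A x y) /\
    is_derive (fun t => (1 - t ^ 2) * uy x t) y (- A x y).

Lemma flux_harmonic_comb (u v : R -> R -> R) (a b : R) :
  flux_harmonic u -> flux_harmonic v ->
  flux_harmonic (fun x y => a * u x y + b * v x y).
Proof.
intros (ux & uy & A & Hu) (vx & vy & B & Hv).
exists (fun x y => a * ux x y + b * vx x y), (fun x y => a * uy x y + b * vy x y),
  (fun x y => a * A x y + b * B x y).
intros x y Hxy.
destruct (Hu x y Hxy) as (Hu1 & Hu2 & Hu3 & Hu4).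
destruct (Hv x y Hxy) as (Hv1 & Hv2 & Hv3 & Hv4).
assert (comb : forall (f g : R -> R) z df dg, is_derive f z df -> is_derive g z dg ->
  is_derive (fun s => a * f s + b * g s) z (a * df + b * dg)).
{ intros f g z df dg Hf Hg.
  apply (is_derive_plus (fun s => a * f s) (fun s => b * g s)); now apply is_derive_scal. }
split; [|split; [|split]].
- now apply (comb (fun s => u s y) (fun s => v s y)).
- now apply (comb (fun t => u x t) (fun t => v x t)).
- apply (is_derive_Rext (fun s => a * ((1 + s ^ 2) * ux s y) + b * ((1 + s ^ 2) * vx s y))).
  { intros s. ring. }
  now apply comb.
- replace (- (a * A x y + b * B x y)) with (a * - A x y + b * - B x y) by ring.
  apply (is_derive_Rext (fun t => a * ((1 - t ^ 2) * uy x t) + b * ((1 - t ^ 2) * vy x t))).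
  { intros t. ring. }
  now apply comb.
Qed.

Lemma continuous_on_comb (D : R * R -> Prop) (f g : R * R -> R) (a b : R) :
  continuous_on D f -> continuous_on D g ->
  continuous_on D (fun p => a * f p + b * g p).
Proof.
intros Hf Hg p Hp.
apply (filterlim_comp_2 (G := locally (f p)) (H := locally (g p)) f g
  (fun s t => a * s + b * t) (Hf p Hp) (Hg p Hp)).
(* Passes from the neighbourhood filter of the pair, used by [continuous_plus], to the product
   filter. *)
apply (filterlim_filter_le_1 (F := locally (f p, g p))
  (G := filter_prod (locally (f p)) (locally (g p)))
  (H := locally (a * f p + b * g p)) (fun q => a * fst q + b * snd q)).
- intros P [e He]. exists (ball (f p) e) (ball (g p) e); [apply locally_ball|apply locally_ball|].
  intros s t Hs Ht. now apply He.
- apply (continuous_plus (fun q : R * R => a * fst q) (fun q : R * R => b * snd q) (f p, g p)).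
  + apply (continuous_scal_r a (fun q : R * R => fst q)), continuous_fst.
  + apply (continuous_scal_r b (fun q : R * R => snd q)), continuous_snd.
Qed.

Lemma continuous_on_star_usc (u : R -> R -> R) (x y s : R) :
  continuous_on Omega0_closure_star (fun p : R * R => u (fst p) (snd p)) ->
  Omega0_closure_star (x, y) -> u x y < s ->
  exists r : posreal, forall x' y', Omega0_closure_star (x', y') ->
    Rabs (x' - x) < r -> Rabs (y' - y) < r -> u x' y' < s.
Proof.
intros Hc Hxy Hs.
destruct (Hc (x, y) Hxy (fun z => z < s) (open_lt s (u x y) Hs)) as [r Hr].
exists r. intros x' y' Hxy' Hx' Hy'.
now apply (Hr (x', y')).
Qed.

(** A positive value of [u] forces a positive maximum of [u - d y] on a truncated strip. The sign
    conditions place it in the interior, where both flux derivatives are at most 0, although their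
    sum is [2 d b > 0]. *)
Lemma maximum_principle (u : R -> R -> R) :
  flux_harmonic u ->
  continuous_on Omega0_closure_star (fun p : R * R => u (fst p) (snd p)) ->
  (forall x, x <> 0 -> u x 0 <= 0) ->
  (forall x, u x 1 <= 0) ->
  (exists r, 0 < r /\ forall x y, Omega0 (x, y) -> Rabs x < r -> y < r -> u x y <= 0) ->
  (forall e, 0 < e -> exists M, forall x y, Omega0 (x, y) -> M < Rabs x -> u x y <= e) ->
  forall x y, Omega0 (x, y) -> u x y <= 0.
Proof.
intros (ux & uy & A & Hu) Hc H0 H1 (r & Hr & Hnear) Hfar x0 y0 Hp0.
apply Rnot_lt_le; intros Hpos.
(* Since [((1 - y^2) * (- y)')' = 2 y > 0], subtracting [d y] turns [u] into a
   strict subsolution. *)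
set (d := u x0 y0 / 2).
destruct (Hfar (d / 2)) as [M HM]; [unfold d; lra|].
(* The rectangle of half-width [K] contains [(x0, y0)], and [u <= d / 2] near its lateral sides
   within the open strip. *)
set (K := Rmax M (Rabs x0) + 1).
assert (HK : M < K /\ Rabs x0 < K).
{ unfold K. pose proof (Rmax_l M (Rabs x0)). pose proof (Rmax_r M (Rabs x0)). lra. }
assert (HK0 : 0 < K) by (pose proof (Rabs_pos x0); lra).
(* The origin gets the value 0. Cutting off at 0 makes [G] upper semicontinuous there, because
   [u <= 0] nearby; a maximum of at least [d > 0] avoids both the origin and the cut-off. *)
set (G := fun x y => if excluded_middle_informative ((x, y) = (0, 0)) then 0
                     else Rmax (u x y - d * y) 0).
assert (HG : forall x y, (x, y) <> (0, 0) -> G x y = Rmax (u x y - d * y) 0).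
{ intros x y Hxy. unfold G. destruct excluded_middle_informative; tauto. }
assert (Hd : 0 < d) by (unfold d; lra).
unfold Omega0 in *; simpl in *.
destruct (usc_attains_max G (- K) K 0 1) as (a & b & Ha & Hb & Hmax); [lra|lra| |].
{ intros x y s Hx Hy Hs.
  destruct (classic ((x, y) = (0, 0))) as [He|He].
  - assert (Hs0 : 0 < s).
    { unfold G in Hs. destruct excluded_middle_informative; tauto. }
    injection He; intros -> ->.
    exists (mkposreal r Hr). simpl. intros x' y' Hx' Hy' Hdx Hdy.
    rewrite Rminus_0_r in Hdx, Hdy. apply Rabs_def2 in Hdy.
    unfold G. destruct excluded_middle_informative as [|Hn]; [exact Hs0|].
    apply Rmax_lub_lt; [|exact Hs0].
    destruct (Req_dec y' 0) as [->|Hy0].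
    + assert (u x' 0 <= 0) by (apply H0; intros ->; tauto). lra.
    + assert (0 <= d * y') by (apply Rmult_le_pos; lra).
      (* [r] may exceed 1, so the top edge can lie within reach. *)
      destruct (Req_dec y' 1) as [->|Hy1].
      * specialize (H1 x'). lra.
      * assert (u x' y' <= 0) by (apply Hnear; lra). lra.
  - rewrite HG in Hs by exact He.
    assert (Hs1 : u x y - d * y < s) by (eapply Rle_lt_trans; [apply Rmax_l|exact Hs]).
    assert (Hs2 : 0 < s) by (eapply Rle_lt_trans; [apply Rmax_r|exact Hs]).
    destruct (continuous_on_star_usc (fun x y => 1 * u x y + - d * y) x y s) as [rr Hrr].
    { apply (continuous_on_comb _ (fun p : R * R => u (fst p) (snd p)) snd); [exact Hc|].
      apply continuous_on_forall. intros p _. apply continuous_snd. }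
    { split; [simpl; lra|exact He]. }
    { lra. }
    exists rr. intros x' y' Hx' Hy' Hdx Hdy.
    unfold G. destruct excluded_middle_informative as [|Hn]; [exact Hs2|].
    apply Rmax_lub_lt; [|exact Hs2].
    assert (1 * u x' y' + - d * y' < s); [|lra].
    apply (Hrr x' y'); trivial. split; [simpl; lra|exact Hn]. }
destruct HK as [HMK HK]; apply Rabs_def2 in HK.
assert (Hstar : forall x y, 0 < y -> (x, y) <> (0, 0)) by (intros x y Hy [=]; lra).
(* [u x0 y0 = 2 d] and [y0 < 1]. *)
assert (HGd : d <= G a b).
{ eapply Rle_trans; [|apply (Hmax x0 y0); lra].
  rewrite HG by (apply Hstar; lra). eapply Rle_trans; [|apply Rmax_l].
  assert (d * y0 <= d * 1) by (apply Rmult_le_compat_l; lra). unfold d in *. lra. }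
assert (Hab : (a, b) <> (0, 0)).
{ intros He. revert HGd. unfold G. destruct excluded_middle_informative; [lra|tauto]. }
assert (Hval : G a b = u a b - d * b).
{ revert HGd. rewrite HG by exact Hab. unfold Rmax. destruct Rle_dec; lra. }
assert (Hdb : 0 <= d * b) by (apply Rmult_le_pos; lra).
assert (Hb0 : 0 < b).
{ destruct Hb as [[?| <-] _]; [assumption|].
  assert (u a 0 <= 0) by (apply H0; intros ->; tauto). lra. }
assert (Hb1 : b < 1).
{ destruct Hb as [_ [?| ->]]; [assumption|]. specialize (H1 a). lra. }
assert (HaK : - K < a < K).
{ assert (Rabs a <= M).
  { apply Rnot_lt_le; intros Hlt. specialize (HM a b (conj Hb0 Hb1) Hlt). lra. }
  apply Rabs_le_between in H. lra. }
assert (Hloc : forall x y, - K <= x <= K -> 0 < y <= 1 ->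
  u x y - d * y <= u a b - d * b).
{ intros x y Hx Hy. rewrite <- Hval.
  eapply Rle_trans; [apply Rmax_l|]. rewrite <- (HG x y) by (apply Hstar; lra).
  apply Hmax; lra. }
(* The x-flux of [u - d y] has derivative [A a b] and its y-flux [- A a b + 2 d b]; both cannot be
   at most 0. *)
destruct (Hu a b (conj Hb0 Hb1)) as (_ & _ & HA & HB).
assert (A a b <= 0).
{ apply (flux_at_max (fun s => u s b) (fun s => ux s b) (fun s => 1 + s ^ 2) (- K) K a).
  - lra.
  - intros x _. apply (Hu x b (conj Hb0 Hb1)).
  - intros x _. nra.
  - intros x Hx. specialize (Hloc x b ltac:(lra) ltac:(lra)). lra.
  - exact HA. }
assert (- A a b + d * (2 * b) <= 0).
{ apply (flux_at_max (fun t => u a t - d * t) (fun t => uy a t - d) (fun t => 1 - t ^ 2) 0 1 b).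
  - lra.
  - intros y Hy. apply (is_derive_minus (fun t => u a t) (fun t => d * t)).
    + apply (Hu a y Hy).
    + auto_derive; [trivial|ring].
  - intros y Hy. nra.
  - intros y Hy. apply (Hloc a y); lra.
  - apply (is_derive_Rext (fun t => (1 - t ^ 2) * uy a t + - d * (1 - t ^ 2))).
    { intros t. ring. }
    apply (is_derive_plus (fun t => (1 - t ^ 2) * uy a t) (fun t => - d * (1 - t ^ 2))).
    + exact HB.
    + auto_derive; [trivial|ring]. }
assert (0 < d * b) by (apply Rmult_lt_0_compat; lra).
lra.
Qed.

(** * Derivatives and regularity of [v0] *)

Lemma rad_sqr (x y : R) : rad x y ^ 2 = x ^ 2 + y ^ 2.
Proof. unfold rad. apply pow2_sqrt. nra. Qed.

Lemma v0_eq (x y : R) : v0 x y = y / (x ^ 2 + y ^ 2).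
Proof. unfold v0. now rewrite rad_sqr. Qed.

Lemma sqr_sum_pos (x y : R) : 0 < y -> 0 < x ^ 2 + y ^ 2.
Proof. intros Hy. nra. Qed.

(** [v0] is minus the imaginary part of [1 / (x + i y)], hence harmonic; its second y-derivative is
    therefore written [- v0xx]. *)
Definition v0x (x y : R) : R := - 2 * x * y / (x ^ 2 + y ^ 2) ^ 2.
Definition v0y (x y : R) : R := (x ^ 2 - y ^ 2) / (x ^ 2 + y ^ 2) ^ 2.
Definition v0xx (x y : R) : R := (6 * x ^ 2 * y - 2 * y ^ 3) / (x ^ 2 + y ^ 2) ^ 3.
Definition v0xy (x y : R) : R := (6 * x * y ^ 2 - 2 * x ^ 3) / (x ^ 2 + y ^ 2) ^ 3.

Ltac derive_rational Hy :=
  auto_derive;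
  [ repeat split; repeat apply Rmult_integral_contrapositive_currified;
    try apply Rgt_not_eq; nra
  | field; apply Rgt_not_eq, sqr_sum_pos, Hy ].

Lemma is_derive_v0_x (x y : R) : 0 < y -> is_derive (fun s => v0 s y) x (v0x x y).
Proof.
intros Hy. apply (is_derive_Rext (fun s => y / (s ^ 2 + y ^ 2))).
{ intros s. symmetry. apply v0_eq. }
unfold v0x. derive_rational Hy.
Qed.

Lemma is_derive_v0_y (x y : R) : 0 < y -> is_derive (fun t => v0 x t) y (v0y x y).
Proof.
intros Hy. apply (is_derive_Rext (fun t => t / (x ^ 2 + t ^ 2))).
{ intros s. symmetry. apply v0_eq. }
unfold v0y. derive_rational Hy.
Qed.

Lemma is_derive_v0x_x (x y : R) : 0 < y -> is_derive (fun s => v0x s y) x (v0xx x y).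
Proof. intros Hy. unfold v0x, v0xx. derive_rational Hy. Qed.

Lemma is_derive_v0x_y (x y : R) : 0 < y -> is_derive (fun t => v0x x t) y (v0xy x y).
Proof. intros Hy. unfold v0x, v0xy. derive_rational Hy. Qed.

Lemma is_derive_v0y_x (x y : R) : 0 < y -> is_derive (fun s => v0y s y) x (v0xy x y).
Proof. intros Hy. unfold v0y, v0xy. derive_rational Hy. Qed.

Lemma is_derive_v0y_y (x y : R) : 0 < y -> is_derive (fun t => v0y x t) y (- v0xx x y).
Proof. intros Hy. unfold v0y, v0xx. derive_rational Hy. Qed.

Lemma continuity_2d_pt_pow (f : R -> R -> R) (n : nat) (x y : R) :
  continuity_2d_pt f x y -> continuity_2d_pt (fun u v => f u v ^ n) x y.
Proof.
intros Hf. induction n as [|n IH]; simpl.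
- apply continuity_2d_pt_const.
- now apply continuity_2d_pt_mult.
Qed.

Ltac continuity_rational :=
  repeat first
    [ apply continuity_2d_pt_id1 | apply continuity_2d_pt_id2
    | apply continuity_2d_pt_const | apply continuity_2d_pt_minus
    | apply continuity_2d_pt_plus | apply continuity_2d_pt_mult
    | apply continuity_2d_pt_pow | apply continuity_2d_pt_opp
    | apply continuity_2d_pt_inv ].

Lemma continuity_v0 (x y : R) : x ^ 2 + y ^ 2 <> 0 -> continuity_2d_pt v0 x y.
Proof.
intros H. apply (continuity_2d_pt_ext (fun x y => y / (x ^ 2 + y ^ 2))).
{ intros s t. symmetry. apply v0_eq. }
unfold Rdiv. continuity_rational. exact H.
Qed.

(** The half-plane [0 < t] is open, so near the point [fx] and [fy] agree with the [Derive] partials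
    that occur in [ex_diff_n]. *)
Lemma ex_diff_n_S (f fx fy : R -> R -> R) (n : nat) (x y : R) :
  (forall s t, 0 < t -> is_derive (fun z => f z t) s (fx s t)) ->
  (forall s t, 0 < t -> is_derive (fun z => f s z) t (fy s t)) ->
  0 < y -> continuity_2d_pt f x y ->
  ex_diff_n fx n x y -> ex_diff_n fy n x y -> ex_diff_n f (S n) x y.
Proof.
intros Hx Hy Hpos Hc Hfx Hfy.
assert (Hloc : locally_2d (fun _ v => 0 < v) x y).
{ exists (mkposreal y Hpos). simpl. intros _ v _ Hv. apply Rabs_def2 in Hv. lra. }
split; [exact Hc|split; [|split; [|split]]].
- exists (fx x y). now apply Hx.
- exists (fy x y). now apply Hy.
- apply (ex_diff_n_ext_loc fx); [|exact Hfx].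
  apply (locally_2d_impl _ _ _ _ (locally_2d_forall _ _ _
    (fun u v (Hv : 0 < v) => eq_sym (is_derive_unique _ _ _ (Hx u v Hv)))) Hloc).
- apply (ex_diff_n_ext_loc fy); [|exact Hfy].
  apply (locally_2d_impl _ _ _ _ (locally_2d_forall _ _ _
    (fun u v (Hv : 0 < v) => eq_sym (is_derive_unique _ _ _ (Hy u v Hv)))) Hloc).
Qed.

Lemma regular_v0 : regular v0.
Proof.
split.
- intros x y [Hy _]. simpl in Hy.
  assert (Hne : x ^ 2 + y ^ 2 <> 0) by (apply Rgt_not_eq, sqr_sum_pos, Hy).
  apply (ex_diff_n_S v0 v0x v0y); trivial.
  + exact is_derive_v0_x.
  + exact is_derive_v0_y.
  + now apply continuity_v0.
  + apply (ex_diff_n_S v0x v0xx v0xy); trivial.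
    * exact is_derive_v0x_x.
    * exact is_derive_v0x_y.
    * unfold v0x, Rdiv. continuity_rational. now apply pow_nonzero.
    * split; trivial. unfold v0xx, Rdiv. continuity_rational. now apply pow_nonzero.
    * split; trivial. unfold v0xy, Rdiv. continuity_rational. now apply pow_nonzero.
  + apply (ex_diff_n_S v0y v0xy (fun x y => - v0xx x y)); trivial.
    * exact is_derive_v0y_x.
    * exact is_derive_v0y_y.
    * unfold v0y, Rdiv. continuity_rational. now apply pow_nonzero.
    * split; trivial. unfold v0xy, Rdiv. continuity_rational. now apply pow_nonzero.
    * split; trivial. unfold v0xx, Rdiv. continuity_rational. now apply pow_nonzero.
- intros [x y] [_ Hne].
  apply (filterlim_filter_le_1 (F := locally (x, y))).
  { apply filter_le_within. }
  apply (continuity_2d_pt_filterlim v0 x y), continuity_v0.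
  intros H. apply Hne. rewrite <- !Rsqr_pow2 in H.
  apply Rplus_sqr_eq_0 in H. destruct H. subst. reflexivity.
Qed.

Lemma is_derive_flux_v0_x (x y : R) : 0 < y ->
  is_derive (fun s => (1 + s ^ 2) * v0x s y) x (2 * x * v0x x y + (1 + x ^ 2) * v0xx x y).
Proof. intros Hy. unfold v0x, v0xx. derive_rational Hy. Qed.

(** This is the equation for [v0]: by harmonicity it reduces to
    [2 x v0x - 2 y v0y + (x^2 + y^2) v0xx = 0]. *)
Lemma is_derive_flux_v0_y (x y : R) : 0 < y ->
  is_derive (fun t => (1 - t ^ 2) * v0y x t) y (- (2 * x * v0x x y + (1 + x ^ 2) * v0xx x y)).
Proof. intros Hy. unfold v0x, v0y, v0xx. derive_rational Hy. Qed.

Lemma flux_harmonic_v0 : flux_harmonic v0.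
Proof.
exists v0x, v0y, (fun x y => 2 * x * v0x x y + (1 + x ^ 2) * v0xx x y).
intros x y [Hy _]. simpl in Hy.
split; [|split; [|split]].
- now apply is_derive_v0_x.
- now apply is_derive_v0_y.
- now apply is_derive_flux_v0_x.
- now apply is_derive_flux_v0_y.
Qed.

(** * Decay of [v0] at infinity and its Dirichlet problem *)

(** Clearing denominators turns decay of a rational function into a polynomial inequality on
    [|x| > 1]. *)
Lemma bigO_infty_rational (k : nat) (f N D : R -> R -> R) (C : R) :
  (forall x y, Omega0 (x, y) -> 1 < Rabs x -> f x y = N x y / D x y /\ 0 < D x y /\
     Rabs (N x y) * Rabs x ^ k <= C * D x y) ->
  bigO_infty k f.
Proof.
intros H. exists C, 1. split; [lra|].
intros x y Hxy Hx. destruct (H x y Hxy Hx) as (-> & HD & Hle).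
assert (Hk : 0 < Rabs x ^ k) by (apply pow_lt; lra).
unfold Rdiv at 1. rewrite Rabs_mult, (Rabs_right (/ D x y)).
2: { apply Rle_ge, Rlt_le, Rinv_0_lt_compat, HD. }
apply (Rmult_le_reg_r (D x y)); [exact HD|].
apply (Rmult_le_reg_r (Rabs x ^ k)); [exact Hk|].
replace (Rabs (N x y) * / D x y * D x y * Rabs x ^ k) with (Rabs (N x y) * Rabs x ^ k)
  by (field; lra).
replace (C / Rabs x ^ k * D x y * Rabs x ^ k) with (C * D x y) by (field; lra).
exact Hle.
Qed.

Lemma bigO1_v0 : bigO1_infty 3 (fun x y => v0 x y - y / x ^ 2).
Proof.
assert (Habs : forall x, 1 < Rabs x ->
  x <> 0 /\ x ^ 2 = Rabs x ^ 2 /\ x ^ 4 = Rabs x ^ 4 /\ forall n, 1 <= Rabs x ^ n).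
{ intros x Hx. split; [intros ->; rewrite Rabs_R0 in Hx; lra|].
  assert (x ^ 2 = Rabs x ^ 2) by now rewrite pow2_abs.
  split; [assumption|split].
  - replace (x ^ 4) with ((x ^ 2) ^ 2) by ring. rewrite H. ring.
  - intros n. apply pow_R1_Rle. lra. }
assert (Hyn : forall y n, 0 < y < 1 -> 0 <= y ^ n <= 1).
{ intros y n Hy. split; [apply pow_le; lra|].
  rewrite <- (pow1 n). apply pow_incr. lra. }
split; [|split].
(* The leading terms cancel, leaving [- y^3 / (x^2 R^2)], of order [|x|^-4]. *)
- apply (bigO_infty_rational 3 _ (fun x y => - y ^ 3)
    (fun x y => x ^ 2 * (x ^ 2 + y ^ 2)) 1).
  intros x y [Hy Hy1] Hx; simpl in Hy, Hy1. destruct (Habs x Hx) as (Hx0 & Hx2 & _ & Ha).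
  pose proof (sqr_sum_pos x y Hy) as HR.
  split; [|split].
  + rewrite v0_eq. field. lra.
  + apply Rmult_lt_0_compat; [|exact HR]. rewrite Hx2. specialize (Ha 2%nat). lra.
  + rewrite Rabs_Ropp, Rabs_right by (apply Rle_ge, pow_le; lra).
    rewrite Hx2. set (a := Rabs x) in *.
    pose proof (Hyn y 3%nat (conj Hy Hy1)). pose proof (Ha 3%nat).
    pose proof (pow2_ge_0 (a * y)).
    assert (y ^ 3 * a ^ 3 <= 1 * a ^ 3) by (apply Rmult_le_compat_r; lra).
    assert (1 * a ^ 3 <= a * a ^ 3) by (apply Rmult_le_compat_r; lra).
    lra.
(* The constant 6 comes from [2 y (2 x^2 y^2 + y^4) <= 6 x^2], valid for [0 < y < 1 < |x|]. *)
- apply (bigO_infty_rational 4 _ (fun x y => 2 * y * (2 * x ^ 2 * y ^ 2 + y ^ 4) * x)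
    (fun x y => x ^ 4 * (x ^ 2 + y ^ 2) ^ 2) 6).
  intros x y [Hy Hy1] Hx; simpl in Hy, Hy1. destruct (Habs x Hx) as (Hx0 & Hx2 & Hx4 & Ha).
  pose proof (sqr_sum_pos x y Hy) as HR.
  split; [|split].
  + unfold dx. apply is_derive_unique.
    replace (2 * y * (2 * x ^ 2 * y ^ 2 + y ^ 4) * x / (x ^ 4 * (x ^ 2 + y ^ 2) ^ 2))
      with (v0x x y - - 2 * y / x ^ 3) by (unfold v0x; field; lra).
    apply (is_derive_minus (fun s => v0 s y) (fun s => y / s ^ 2)).
    { now apply is_derive_v0_x. }
    auto_derive; [repeat split; nra|field; exact Hx0].
  + apply Rmult_lt_0_compat; [|now apply pow_lt]. rewrite Hx4. specialize (Ha 4%nat). lra.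
  + rewrite Rabs_mult, Rabs_right.
    2: { apply Rle_ge. pose proof (Hyn y 4%nat (conj Hy Hy1)).
      pose proof (pow2_ge_0 (x * y)).
      apply Rmult_le_pos; [lra|]. lra. }
    rewrite Hx4, Hx2. set (a := Rabs x) in *.
    pose proof (Hyn y 2%nat (conj Hy Hy1)). pose proof (Hyn y 4%nat (conj Hy Hy1)).
    pose proof (Ha 2%nat). pose proof (Ha 3%nat). pose proof (Ha 4%nat).
    assert (E1 : 0 <= a ^ 2 * y ^ 2 <= a ^ 2 * 1).
    { split; [apply Rmult_le_pos|apply Rmult_le_compat_l]; lra. }
    assert (E2 : 2 * y * (2 * a ^ 2 * y ^ 2 + y ^ 4) <= 2 * (3 * a ^ 2)).
    { apply Rmult_le_compat; lra. }
    assert (E3 : 2 * y * (2 * a ^ 2 * y ^ 2 + y ^ 4) * a <= 2 * (3 * a ^ 2) * a).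
    { apply Rmult_le_compat_r; lra. }
    assert (E4 : 1 * a ^ 3 <= a * a ^ 3) by (apply Rmult_le_compat_r; lra).
    assert (E5 : a ^ 4 <= (a ^ 2 + y ^ 2) ^ 2).
    { replace (a ^ 4) with ((a ^ 2) ^ 2) by ring. apply pow_incr. lra. }
    replace (6 * (a ^ 4 * (a ^ 2 + y ^ 2) ^ 2)) with (6 * (a ^ 2 + y ^ 2) ^ 2 * a ^ 4) by ring.
    apply Rmult_le_compat_r; lra.
(* The constant 4 comes from [3 x^2 y^2 + y^4 <= 4 x^2]. *)
- apply (bigO_infty_rational 4 _ (fun x y => - (3 * x ^ 2 * y ^ 2 + y ^ 4))
    (fun x y => x ^ 2 * (x ^ 2 + y ^ 2) ^ 2) 4).
  intros x y [Hy Hy1] Hx; simpl in Hy, Hy1. destruct (Habs x Hx) as (Hx0 & Hx2 & _ & Ha).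
  pose proof (sqr_sum_pos x y Hy) as HR.
  split; [|split].
  + unfold dy. apply is_derive_unique.
    replace (- (3 * x ^ 2 * y ^ 2 + y ^ 4) / (x ^ 2 * (x ^ 2 + y ^ 2) ^ 2))
      with (v0y x y - 1 / x ^ 2) by (unfold v0y; field; lra).
    apply (is_derive_minus (fun t => v0 x t) (fun t => t / x ^ 2)).
    { now apply is_derive_v0_y. }
    auto_derive; [repeat split; nra|field; exact Hx0].
  + apply Rmult_lt_0_compat; [|now apply pow_lt]. rewrite Hx2. specialize (Ha 2%nat). lra.
  + pose proof (Hyn y 2%nat (conj Hy Hy1)). pose proof (Hyn y 4%nat (conj Hy Hy1)).
    pose proof (pow2_ge_0 (x * y)).
    rewrite Rabs_Ropp, Rabs_right by lra.
    rewrite Hx2. set (a := Rabs x) in *.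
    pose proof (Ha 2%nat). pose proof (Ha 4%nat). pose proof (pow2_ge_0 (a * y)).
    assert (E3 : a ^ 2 * y ^ 2 <= a ^ 2 * 1) by (apply Rmult_le_compat_l; lra).
    assert (E5 : a ^ 4 <= (a ^ 2 + y ^ 2) ^ 2).
    { replace (a ^ 4) with ((a ^ 2) ^ 2) by ring. apply pow_incr. lra. }
    rewrite <- Rmult_assoc.
    apply Rmult_le_compat; lra.
Qed.

Lemma littleo_zero_eq0 (k : nat) (f : R -> R -> R) :
  (forall x y, f x y = 0) -> littleo_zero k f.
Proof.
intros Hf e. apply filter_forall. intros p. rewrite Hf.
change (Rabs 0 <= e * norm (/ rad (fst p) (snd p) ^ k)). rewrite Rabs_R0.
apply Rmult_le_pos; [apply Rlt_le, cond_pos|apply norm_ge_0].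
Qed.

Lemma dirichlet_v0 : dirichlet_problem v0.
Proof.
assert (Hx : forall x y, 0 < y -> dx v0 x y = v0x x y).
{ intros x y Hy. now apply is_derive_unique, is_derive_v0_x. }
assert (Hy : forall x y, 0 < y -> dy v0 x y = v0y x y).
{ intros x y H. now apply is_derive_unique, is_derive_v0_y. }
assert (Hz : forall x y, v0 x y - y / rad x y ^ 2 = 0).
{ intros x y. unfold v0. ring. }
split; [|split; [|split; [|split]]].
- intros x y [H _]. simpl in H.
  assert (H1 : dx (fun s t => (1 + s ^ 2) * dx v0 s t) x y =
            2 * x * v0x x y + (1 + x ^ 2) * v0xx x y).
  { apply is_derive_unique.
    apply (is_derive_Rext (fun s => (1 + s ^ 2) * v0x s y)).
    { intros s. now rewrite Hx. }
    now apply is_derive_flux_v0_x. }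
  assert (H2 : dy (fun s t => (1 - t ^ 2) * dy v0 s t) x y =
            - (2 * x * v0x x y + (1 + x ^ 2) * v0xx x y)).
  { apply is_derive_unique.
    (* [dy v0 = v0y] is known only for [t > 0], so the comparison is local. *)
    apply (is_derive_ext_loc (fun t => (1 - t ^ 2) * v0y x t)).
    { apply (filter_imp (fun t => 0 < t)); [|now apply open_gt].
      intros t Ht. now rewrite Hy. }
    now apply is_derive_flux_v0_y. }
  rewrite H1, H2. ring.
- intros x _. unfold v0, Rdiv. ring.
- intros x. rewrite v0_eq. f_equal. ring.
- exact bigO1_v0.
- split; [|split]; apply littleo_zero_eq0; intros x y.
  + apply Hz.
  + unfold dx. rewrite (Derive_ext _ (fun _ => 0)); [apply Derive_const|].
    intros s. apply Hz.
  + unfold dy. rewrite (Derive_ext _ (fun _ => 0)); [apply Derive_const|].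
    intros s. apply Hz.
Qed.

(** * Comparison of an arbitrary solution with [v0] *)

(** [Derive] is total; regularity turns the terms of the equation into genuine derivatives. *)
Lemma flux_harmonic_solution (v : R -> R -> R) :
  regular v -> dirichlet_problem v -> flux_harmonic v.
Proof.
intros [Hr _] [Heq _].
exists (dx v), (dy v), (fun x y => dx (fun s t => (1 + s ^ 2) * dx v s t) x y).
intros x y Hxy.
destruct (Hr x y Hxy) as (_ & Hx & Hy & Hxx & Hyy).
split; [|split; [|split]].
- now apply Derive_correct.
- now apply Derive_correct.
- apply Derive_correct. apply ex_derive_mult.
  + auto_derive. trivial.
  + apply Hxx.
- replace (- dx (fun s t => (1 + s ^ 2) * dx v s t) x y)
    with (dy (fun s t => (1 - t ^ 2) * dy v s t) x y).
  2: { specialize (Heq x y Hxy). lra. }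
  apply Derive_correct. apply (ex_derive_mult (fun t => 1 - t ^ 2) (fun t => dy v x t)).
  + auto_derive. trivial.
  + apply Hyy.
Qed.

Lemma littleo_zero_bound (k : nat) (f : R -> R -> R) (e : R) :
  littleo_zero k f -> 0 < e ->
  exists r, 0 < r /\ forall x y, Omega0 (x, y) -> Rabs x < r -> y < r ->
    Rabs (f x y) * rad x y ^ k <= e.
Proof.
intros Hf He. destruct (Hf (mkposreal e He)) as [r Hr].
exists r. split; [apply cond_pos|].
intros x y [Hy Hy1] Hx Hyr. simpl in Hy, Hy1.
assert (Hrad : 0 < rad x y) by (apply sqrt_lt_R0, sqr_sum_pos, Hy).
assert (Hk : 0 < rad x y ^ k) by (apply pow_lt, Hrad).
assert (H : Rabs (f x y) <= e * Rabs (/ rad x y ^ k)).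
{ apply (Hr (x, y)); [|split; assumption]. split.
  - change (Rabs (x - 0) < r). now rewrite Rminus_0_r.
  - change (Rabs (y - 0) < r). rewrite Rminus_0_r, Rabs_right; lra. }
rewrite (Rabs_right (/ _)) in H by (apply Rle_ge, Rlt_le, Rinv_0_lt_compat, Hk).
replace e with (e * / rad x y ^ k * rad x y ^ k) by (field; lra).
apply Rmult_le_compat_r; lra.
Qed.

(* An [o(1/R)] function is not dominated by [v0 = y/R^2] close to [y = 0]; there
   the derivative bound is integrated from the boundary [y = 0] instead. *)
Lemma small_near_zero (w : R -> R -> R) (e : R) :
  continuous_on Omega0_closure_star (fun p : R * R => w (fst p) (snd p)) ->
  (forall x, x <> 0 -> w x 0 = 0) ->
  (forall x y, Omega0 (x, y) -> ex_derive (fun t => w x t) y) ->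
  littleo_zero 1 w -> littleo_zero 2 (dy w) -> 0 < e ->
  exists r, 0 < r /\ forall x y, Omega0 (x, y) -> Rabs x < r -> y < r ->
    Rabs (w x y) <= e * v0 x y.
Proof.
intros Hc H0 Hd Hw Hdw He.
destruct (littleo_zero_bound 1 w (e / 2) Hw) as (r1 & Hr1 & H1); [lra|].
destruct (littleo_zero_bound 2 (dy w) (e / 2) Hdw) as (r2 & Hr2 & H2); [lra|].
exists (Rmin r1 r2). split; [now apply Rmin_pos|].
intros x y [Hy Hy1] Hx Hyr. simpl in Hy, Hy1.
pose proof (Rmin_l r1 r2). pose proof (Rmin_r r1 r2).
assert (HR : 0 < x ^ 2 + y ^ 2) by (apply sqr_sum_pos, Hy).
rewrite v0_eq.
apply (Rmult_le_reg_r (x ^ 2 + y ^ 2)); [exact HR|].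
replace (e * (y / (x ^ 2 + y ^ 2)) * (x ^ 2 + y ^ 2)) with (e * y) by (field; lra).
destruct (Rle_lt_dec (Rabs x) y) as [Hxy|Hxy].
(* In the sector [|x| <= y] one has [R <= 2 y], so [|w| R^2 <= (e / 2) R <= e y]. *)
- specialize (H1 x y (conj Hy Hy1) ltac:(lra) ltac:(lra)).
  rewrite pow_1 in H1. rewrite <- rad_sqr.
  assert (Hrad : rad x y <= 2 * y).
  { apply Rsqr_incr_0_var; [|lra]. rewrite !Rsqr_pow2, rad_sqr, <- (pow2_abs x).
    pose proof (Rabs_pos x). nra. }
  assert (0 <= rad x y) by apply sqrt_pos. nra.
- assert (Hx0 : x <> 0) by (intros ->; rewrite Rabs_R0 in Hxy; lra).
  assert (Hx2 : 0 < x ^ 2) by nra.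
  assert (Hyx : y ^ 2 <= x ^ 2) by (rewrite <- (pow2_abs x); nra).
  assert (Hmain : Rabs (w x y) <= e / 2 / x ^ 2 * y).
  (* [w] is differentiable only inside the strip, so integration starts at a height [s > 0] where
     continuity at [(x, 0)] gives [|w| < eta]. *)
  { apply le_epsilon. intros eta Heta.
    destruct (Hc (x, 0)) with (P := fun z => Rabs z < eta) as [d Hdlt].
    { split; [simpl; lra|]. intros [=]. tauto. }
    { simpl. rewrite H0 by exact Hx0. exists (mkposreal eta Heta). intros z Hz.
      change (Rabs (z - 0) < eta) in Hz. now rewrite Rminus_0_r in Hz. }
    pose proof (cond_pos d).
    set (s := Rmin d y / 2).
    assert (Hs : 0 < s /\ s < d /\ s < y).
    { unfold s. pose proof (Rmin_l d y). pose proof (Rmin_r d y).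
      assert (0 < Rmin d y) by (apply Rmin_pos; lra). lra. }
    assert (Hws : Rabs (w x s) < eta).
    { apply (Hdlt (x, s)).
      - split; [apply ball_center|]. change (Rabs (s - 0) < d).
        rewrite Rminus_0_r, Rabs_right; lra.
      - split; [simpl; lra|]. intros [=]. tauto. }
    destruct (MVT_cor2 (fun t => w x t) (fun t => dy w x t) s y) as (c & Heq & Hcs).
    { lra. }
    { intros t Ht. apply is_derive_Reals, Derive_correct, Hd. split; simpl; lra. }
    specialize (H2 x c (conj (ltac:(simpl; lra) : 0 < c) (ltac:(simpl; lra) : c < 1))
      ltac:(lra) ltac:(lra)).
    rewrite rad_sqr in H2.
    (* Uses [x^2 <= x^2 + c^2]. *)
    assert (Hdc : Rabs (dy w x c) <= e / 2 / x ^ 2).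
    { apply (Rmult_le_reg_r (x ^ 2)); [exact Hx2|].
      replace (e / 2 / x ^ 2 * x ^ 2) with (e / 2) by (field; exact Hx0).
      pose proof (Rabs_pos (dy w x c)). nra. }
    replace (w x y) with (w x s + dy w x c * (y - s)) by lra.
    eapply Rle_trans; [apply Rabs_triang|].
    rewrite Rabs_mult, (Rabs_right (y - s)) by lra.
    pose proof (Rabs_pos (dy w x c)).
    assert (Rabs (dy w x c) * (y - s) <= e / 2 / x ^ 2 * y)
      by (apply Rmult_le_compat; lra).
    lra. }
  (* Here [y < |x|] gives [R^2 <= 2 x^2]; the factor 2 absorbs the half in [e / 2]. *)
  apply (Rle_trans _ (e / 2 / x ^ 2 * y * (2 * x ^ 2))).
  + apply Rmult_le_compat; [apply Rabs_pos|lra|exact Hmain|lra].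
  + right. field. exact Hx0.
Qed.

(** The condition [a^2 = 1] covers both signs of [v - v0] in one application of the maximum
    principle. *)
Lemma solution_near_v0 (v : R -> R -> R) (a e : R) :
  regular v -> dirichlet_problem v -> a ^ 2 = 1 -> 0 < e ->
  forall x y, Omega0 (x, y) -> a * (v x y - v0 x y) <= e * v0 x y.
Proof.
intros Hreg Hdir Ha He x y Hxy.
pose proof (flux_harmonic_solution v Hreg Hdir) as Hflux.
destruct Hreg as [Hr Hc].
destruct Hdir as (_ & Hv0 & Hv1 & [(C & M & HM & Hinf) _] & Ho & _ & Hoy).
destruct bigO1_v0 as [(C' & M' & HM' & Hinf') _].
assert (Hpos : forall x y, 0 <= y -> 0 <= v0 x y).
{ intros s t Ht. unfold v0, Rdiv.
  (* At the origin the convention [/ 0 = 0] makes [v0] vanish. *)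
  destruct (Req_dec (rad s t) 0) as [H|H].
  - rewrite H. rewrite pow_i by auto. rewrite Rinv_0. lra.
  - apply Rmult_le_pos; [exact Ht|]. apply Rlt_le, Rinv_0_lt_compat. nra. }
assert (Habs : forall z, a * z <= Rabs z).
{ intros z. assert (a = 1 \/ a = -1) as [-> | ->] by (assert ((a - 1) * (a + 1) = 0) as H by lra;
    apply Rmult_integral in H; lra).
  - rewrite Rmult_1_l. apply Rle_abs.
  - rewrite <- Rabs_Ropp. replace (-1 * z) with (- z) by ring. apply Rle_abs. }
assert (Hb0 : forall x, v0 x 0 = 0) by (intros s; unfold v0, Rdiv; ring).
assert (Hcw : continuous_on Omega0_closure_star
  (fun p : R * R => v (fst p) (snd p) - snd p / rad (fst p) (snd p) ^ 2)).
{ apply (continuous_on_ext _ (fun p : R * R => 1 * v (fst p) (snd p) + -1 * v0 (fst p) (snd p))).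
  { intros p _.
    change (1 * v (fst p) (snd p) + -1 * v0 (fst p) (snd p)
      = v (fst p) (snd p) - v0 (fst p) (snd p)).
    ring. }
  apply (continuous_on_comb _ (fun p => v (fst p) (snd p)) (fun p => v0 (fst p) (snd p)));
    [exact Hc|apply regular_v0]. }
(* This is [a (v - v0) - e v0], regrouped as a linear combination of [v] and [v0]. *)
assert (H : a * v x y + (- a - e) * v0 x y <= 0); [|lra].
revert x y Hxy.
apply (maximum_principle (fun x y => a * v x y + (- a - e) * v0 x y)).
- apply flux_harmonic_comb; [exact Hflux|exact flux_harmonic_v0].
- apply (continuous_on_comb _ (fun p => v (fst p) (snd p)) (fun p => v0 (fst p) (snd p)));
    [exact Hc|apply regular_v0].
- intros x Hx. rewrite Hv0, Hb0 by exact Hx. lra.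
- intros x. assert (Heq : v x 1 = v0 x 1).
  { rewrite Hv1, v0_eq. f_equal. ring. }
  rewrite Heq. assert (0 <= e * v0 x 1) by (apply Rmult_le_pos; [|apply Hpos]; lra). lra.
- destruct (small_near_zero (fun x y => v x y - y / rad x y ^ 2) e Hcw) as (r & Hr0 & Hsmall); trivial.
  { intros x Hx. rewrite Hv0 by exact Hx. unfold Rdiv. ring. }
  { intros x y Hxy. apply (ex_derive_minus (fun t => v x t) (fun t => v0 x t)).
    - apply (Hr x y Hxy).
    - exists (v0y x y). apply is_derive_v0_y, Hxy. }
  exists r. split; [exact Hr0|]. intros x y Hxy Hx Hy.
  specialize (Hsmall x y Hxy Hx Hy). fold (v0 x y) in Hsmall.
  specialize (Habs (v x y - v0 x y)). lra.
- intros d Hd.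
  (* Beyond [M] and [M'] both decay bounds hold; [|x| > 1] and [|x| > (C + C') / d] then give
     [(C + C') / |x|^3 <= d]. *)
  exists (Rmax (Rmax M M') (Rmax 1 ((C + C') / d))). intros x y Hxy Hx.
  pose proof (Rmax_l (Rmax M M') (Rmax 1 ((C + C') / d))).
  pose proof (Rmax_r (Rmax M M') (Rmax 1 ((C + C') / d))).
  pose proof (Rmax_l M M'). pose proof (Rmax_r M M').
  pose proof (Rmax_l 1 ((C + C') / d)). pose proof (Rmax_r 1 ((C + C') / d)).
  specialize (Hinf x y Hxy ltac:(lra)). specialize (Hinf' x y Hxy ltac:(lra)).
  assert (Hw : Rabs (v x y - v0 x y) <= (C + C') / Rabs x ^ 3).
  (* The common leading term [y / x^2] cancels. *)
  { replace (v x y - v0 x y) with ((v x y - y / x ^ 2) + - (v0 x y - y / x ^ 2)) by ring.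
    eapply Rle_trans; [apply Rabs_triang|]. rewrite Rabs_Ropp.
    replace ((C + C') / Rabs x ^ 3) with (C / Rabs x ^ 3 + C' / Rabs x ^ 3)
      by (field; lra). lra. }
  assert (Hle : (C + C') / Rabs x ^ 3 <= d).
  { assert (Hx3 : 0 < Rabs x ^ 3) by (apply pow_lt; lra).
    apply (Rmult_le_reg_r (Rabs x ^ 3)); [exact Hx3|].
    replace ((C + C') / Rabs x ^ 3 * Rabs x ^ 3) with ((C + C') / d * d) by (field; lra).
    assert (Rabs x * 1 <= Rabs x * Rabs x ^ 2).
    { apply Rmult_le_compat_l; [lra|]. apply pow_R1_Rle. lra. }
    rewrite (Rmult_comm d). apply Rmult_le_compat_r; [lra|]. simpl in *. lra. }
  specialize (Habs (v x y - v0 x y)).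
  assert (0 <= e * v0 x y) by (apply Rmult_le_pos; [lra|]; apply Hpos, Rlt_le, Hxy).
  lra.
Qed.

Theorem theorem4p2 :
  (regular v0 /\ dirichlet_problem v0) /\
  (forall v : R -> R -> R,
     regular v -> dirichlet_problem v ->
     forall x y : R, Omega0_closure_star (x, y) -> v x y = v0 x y).
Proof.
split; [split; [exact regular_v0|exact dirichlet_v0]|].
intros v Hreg Hdir x y [Hy Hne]. simpl in Hy.
pose proof Hdir as (_ & Hv0 & Hv1 & _).
destruct (Req_dec y 0) as [->|H0].
{ rewrite Hv0 by (intros ->; tauto). unfold v0, Rdiv. ring. }
destruct (Req_dec y 1) as [->|H1].
{ rewrite Hv1, v0_eq. f_equal. ring. }
assert (Hxy : Omega0 (x, y)) by (split; simpl; lra).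
assert (Hpos : 0 < v0 x y).
{ rewrite v0_eq. apply Rdiv_lt_0_compat; [lra|apply sqr_sum_pos; lra]. }
(* At a fixed point [e = eta / v0 x y] makes the error [e v0] equal to [eta]. *)
apply Rle_antisym; apply le_epsilon; intros eta Heta.
- pose proof (solution_near_v0 v 1 (eta / v0 x y) Hreg Hdir ltac:(lra)
    (Rdiv_lt_0_compat _ _ Heta Hpos) x y Hxy) as H.
  replace (eta / v0 x y * v0 x y) with eta in H by (field; lra). lra.
- pose proof (solution_near_v0 v (-1) (eta / v0 x y) Hreg Hdir ltac:(lra)
    (Rdiv_lt_0_compat _ _ Heta Hpos) x y Hxy) as H.
  replace (eta / v0 x y * v0 x y) with eta in H by (field; lra). lra.
Qed.
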